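(* Let $k\ge 2$ be an integer and let $q_1,\dots,q_k$ be positive integers. Let $\{\mathcal{U}^{(k)}_n\}_{n\ge 0}$ be the $k$-generalized Horadam sequence with coefficients $q_1,\dots,q_k$, and let $\{\mathcal{V}^{(k)}_n\}_{n\ge 0}$ be a $k$-generalized Horadam-like sequence with the same coefficients. Then for all $n\ge k$, $$\mathcal{V}^{(k)}_n = q_k\mathcal{V}^{(k)}_0\, \mathcal{U}^{(k)}_{n-1}+\sum_{m=0}^{k-3}\left(\mathcal{V}^{(k)}_{m+1}\sum_{j=0}^{m+1} q_{k-(m+1)+j}\;\mathcal{U}^{(k)}_{n-1-j}\right) + \mathcal{V}^{(k)}_{k-1}\;\mathcal{U}^{(k)}_n .$$
   Context: For an integer $k\ge 2$ and positive integers $q_1,\dots,q_k$, the $k$-generalized Horadam sequence $\{\mathcal{U}^{(k)}_n\}_{n\ge0}$ is defined by $\mathcal{U}^{(k)}_i=0$ for $0\le i<k-1$, $\mathcal{U}^{(k)}_{k-1}=1$, and $\mathcal{U}^{(k)}_n=\sum_{i=1}^k q_i\,\mathcal{U}^{(k)}_{n-i}$ for $n\ge k$. A $k$-generalized Horadam-like sequence $\{\mathcal{V}^{(k)}_n\}_{n\ge0}$ satisfies the same recurrence $\mathcal{V}^{(k)}_n=\sum_{i=1}^k q_i\,\mathcal{V}^{(k)}_{n-i}$ for $n\ge k$, with initial values $\mathcal{V}^{(k)}_i=a_i$ for $0\le i\le k-1$, where the $a_i$ are nonnegative integers, at least one of which is nonzero. When $k=2$ the sum over $m$ from $0$ to $k-3$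 is empty and equals $0$. *)

(* Defs.v *)
From mathcomp Require Import all_boot.

Set Implicit Arguments.
Unset Strict Implicit.
Unset Printing Implicit Defensive.

(* The coefficients q_1, ..., q_k are the values q 1, ..., q k of a function
   q : nat -> nat; its values outside [1, k] are never used. For k <= n and
   i <= k the truncated subtraction n - i is the ordinary one. *)
Definition horadam_recurrence (k : nat) (q W : nat -> nat) : Prop :=
  forall n : nat, k <= n -> W n = \sum_(1 <= i < k.+1) q i * W (n - i).

Definition generalized_horadam (k : nat) (q U : nat -> nat) : Prop :=
  [/\ forall i : nat, i < k.-1 -> U i = 0,
      U k.-1 = 1
    & horadam_recurrence k q U].

(* The initial values a_0, ..., a_(k-1) are V 0, ..., V k.-1 themselves. *)
Definition generalized_horadam_like (k : nat) (q V : nat -> nat) : Prop :=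
  (exists2 i : nat, i < k & V i <> 0) /\ horadam_recurrence k q V.

(* Main.v *)
(* Write c_m(n) = \sum_(j <= m) q_(k-m+j) U_(n-1-j) for the coefficient of V_m.
   Then c_(k-1)(n) = U_n for n >= k, and c_(m+1)(n+1) = c_m(n) + q_(k-m-1) U_n.
   The formula V_n = \sum_(m < k-1) V_m c_m(n) + V_(k-1) U_n, for all solutions V
   of the recurrence at once, follows by induction on n >= k-1: the value at n+1
   is that of the shifted solution V_(.+1) at n, whose last initial value V_k is
   expanded by the recurrence. *)
Require Import Defs.
From mathcomp Require Import all_boot.

Definition horadam_coef (k : nat) (q U : nat -> nat) (m n : nat) : nat :=
  \sum_(0 <= j < m.+1) q (k - m + j) * U (n - 1 - j).

Lemma horadam_recurrence_shift (k : nat) (q W : nat -> nat) :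
  horadam_recurrence k q W -> horadam_recurrence k q (fun n => W n.+1).
Proof.
move=> recW n le_kn; rewrite recW ?leqW //.
apply: eq_big_nat => i /andP[_ lt_ik].
by rewrite subSn // (leq_trans _ le_kn).
Qed.

Lemma horadam_recurrence_rev (k : nat) (q W : nat -> nat) :
  horadam_recurrence k q W -> W k = \sum_(0 <= m < k) W m * q (k - m).
Proof.
move=> recW; rewrite recW // big_add1 big_nat_rev /= add0n.
apply: eq_big_nat => m /andP[_ lt_mk].
by rewrite -subSn // subSS subKn 1?ltnW // mulnC.
Qed.

(** The [j = 0] term splits off. In the others, replacing [j] by [j.+1] cancels the shifts of [m]
    and [n]; [m < k] keeps [k - m.+1] from truncating. *)
Lemma horadam_coefS (k : nat) (q U : nat -> nat) (m n : nat) :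
  m < k ->
  horadam_coef k q U m.+1 n.+1 = q (k - m.+1) * U n + horadam_coef k q U m n.
Proof.
move=> lt_mk; rewrite /horadam_coef big_nat_recl // addn0 subn1 subn0.
congr (_ + _); apply: eq_big_nat => j _.
by rewrite addnS -addSn subnSK // !subn1 subnS predn_sub.
Qed.

(** For [m = k] the weights are [q 1, ..., q k.+1], so the sum is the right-hand side of the
    recurrence, available only from [n = k.+1] on. *)
Lemma horadam_coef_top (k : nat) (q U : nat -> nat) (n : nat) :
  horadam_recurrence k.+1 q U -> k < n -> horadam_coef k.+1 q U k n = U n.
Proof.
move=> recU lt_kn; rewrite recU // big_add1 /horadam_coef.
by apply: eq_bigr => j _; rewrite subSnn add1n -subnDA add1n.
Qed.

(** Every index [k - 1 - j] lies below [k], because [m < k] makes [k] positive. *)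
Lemma horadam_coef_base (k : nat) (q U : nat -> nat) (m : nat) :
  (forall i, i < k -> U i = 0) -> m < k -> horadam_coef k.+1 q U m k = 0.
Proof.
move=> U0 lt_mk; rewrite /horadam_coef big1 // => j _.
rewrite U0 ?muln0 // (leq_ltn_trans (leq_subr _ _)) // subn1 prednK //.
exact: leq_ltn_trans lt_mk.
Qed.

Lemma horadam_like_expansion (k : nat) (q U V : nat -> nat) (p : nat) :
  generalized_horadam k.+1 q U -> horadam_recurrence k.+1 q V ->
  V (k + p) = \sum_(0 <= m < k) V m * horadam_coef k.+1 q U m (k + p)
              + V k * U (k + p).
Proof.
case=> /= U0 Uk recU; elim: p V => [|p IHp] V recV.
  rewrite addn0 Uk muln1 big_nat_cond big1 // => m.
  by rewrite andbT => /andP[_ lt_mk]; rewrite horadam_coef_base ?muln0.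
have lt_kp : k < k + p.+1 by rewrite addnS ltnS leq_addr.
(* The last term becomes the summand [m = k], giving a single sum over [m <= k]. *)
rewrite -(horadam_coef_top _ _ _ _ recU lt_kp) -big_nat_recr //= addnS.
rewrite (IHp _ (horadam_recurrence_shift _ _ _ recV)).
(* With [m = 0] split off on both sides, the [V 0] terms agree and the coefficients of each [V m.+1]
   are compared by [horadam_coefS]. *)
rewrite (horadam_recurrence_rev _ _ _ recV) !big_nat_recl //.
have -> : horadam_coef k.+1 q U 0 (k + p).+1 = q k.+1 * U (k + p).
  by rewrite /horadam_coef big_nat1 addn0 subn1 !subn0.
rewrite mulnDl subn0 mulnA addnCA; congr (_ + _).
rewrite big_distrl -big_split; apply: eq_big_nat => m /andP[_ lt_mk] /=.
by rewrite horadam_coefS ?leqW // mulnDr mulnA addnC.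
Qed.

Theorem theorem2p5 (k : nat) (q U V : nat -> nat)
    (hk : 2 <= k)
    (hq : forall i : nat, 1 <= i <= k -> 0 < q i)
    (hU : generalized_horadam k q U)
    (hV : generalized_horadam_like k q V)
    (n : nat) (hn : k <= n) :
  V n = q k * V 0 * U (n - 1)
        + \sum_(0 <= m < k - 2)
            (V (m + 1) * \sum_(0 <= j < m + 2) q (k - (m + 1) + j) * U (n - 1 - j))
        + V (k - 1) * U n.
Proof.
case: k hk hU hV hn {hq} => [|[|k]] // _ hU [_ recV] hn.
(* The order is now [k.+2], so the last initial index is [k.+1]; the [m = 0] summand then gives the
   separate [V 0] term. *)
have := horadam_like_expansion _ _ _ _ (n - k.+1) hU recV.
rewrite subnKC 1?ltnW // => ->; rewrite big_nat_recl // !subSS !subn0.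
rewrite /horadam_coef big_nat1 addn0 !subn0 mulnCA mulnA.
by congr (_ + _ + _); apply: eq_bigr => m _; rewrite addn1 addn2.
Qed.
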